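(* Let $X$ be a Fréchet space over $\mathbb{K}$, $(p_n)_{n\ge1}$ an increasing sequence of seminorms defining the topology of $X$, and $(\varepsilon_n)_{n\ge1}$ a sequence of positive real numbers such that $\prod_{n}(1+\varepsilon_n)=K<\infty$. If a sequence $(u_k)_{k\ge1}\subset X$ satisfies, for any $n\ge 1$, any $j\le n$ and any $a_1,\dots,a_{n+1}\in\mathbb{K}$, $$p_j\Big(\sum_{k=1}^n a_ku_k\Big)\le(1+\varepsilon_n)\,p_j\Big(\sum_{k=1}^{n+1}a_ku_k\Big)\quad\text{and}\quad p_1(u_n)=1,$$ then $(u_k)$ is a basic sequence in $X$ and the closure $M_u$ of the linear span of $(u_k)$ satisfies $M_u\cap\ker p_1=\{0\}$. Moreover, if $(f_k)_{k\ge1}\subset X$ satisfies $$\sum_{k=1}^{+\infty}2K\,p_k(u_k-f_k)<1,$$ then $(f_k)$ is a basic sequence in $X$, $(f_k)$ is equivalent to $(u_k)$, and the closure $M_f$ of the linear span of $(f_k)$ satisfies $M_f\cap\ker p_1=\{0\}$.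
   Context: $\mathbb{K}=\mathbb{R}$ or $\mathbb{C}$. A sequence $(u_n)_{n\ge1}$ in a Fréchet space is basic if for every $x\in\overline{\mathrm{span}}\{u_n:n\ge1\}$ there exists a unique sequence $(a_n)_{n\ge1}$ in $\mathbb{K}$ such that $x=\sum_{n=1}^\infty a_nu_n$. Two basic sequences $(u_n)$ and $(f_n)$ in $X$ are equivalent if for every sequence $(a_n)_{n\ge1}$ in $\mathbb{K}$, the series $\sum_{n=1}^\infty a_nu_n$ converges in $X$ if and only if $\sum_{n=1}^\infty a_nf_n$ converges in $X$. *)

(* Defs.v *)
From HB Require Import structures.
From mathcomp Require Import all_boot all_order all_algebra.
From mathcomp Require Import all_classical all_reals all_analysis.
From mathcomp Require Import complex.

Set Implicit Arguments.
Unset Strict Implicit.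
Unset Printing Implicit Defensive.

Import Order.TTheory GRing.Theory Num.Theory.
Import numFieldNormedType.Exports.

Local Open Scope classical_set_scope.
Local Open Scope ring_scope.

Variant scalar_kind := RealScalars | ComplexScalars.

Definition scalars (R : realType) (k : scalar_kind) : numFieldType :=
  match k with
  | RealScalars => R
  | ComplexScalars => R[i]
  end.

(* The norm of the numFieldType R[i] takes its values in R[i]; seminorms are
   R-valued, so homogeneity is expressed with an R-valued modulus. *)
Definition modulus (R : realType) (k : scalar_kind) : scalars R k -> R :=
  match k return scalars R k -> R with
  | RealScalars => fun a : R => `|a|
  | ComplexScalars => fun z : R[i] => ComplexField.Normc.normc z
  end.

Section Frechet.
Variables (R : realType) (k : scalar_kind).
Variable X : topologicalLmodType (scalars R k).

Definition seminorm (p : X -> R) : Prop :=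
  [/\ forall x, 0 <= p x,
      forall x y, p (x + y) <= p x + p y &
      forall (a : scalars R k) x, p (a *: x) = modulus a * p x].

(* The topology of X is the one generated by the seminorms p 0, p 1, and so on:
   finite intersections of p-balls centred at x form a base at x. *)
Definition defines_topology (p : nat -> X -> R) : Prop :=
  forall (x : X) (A : set X),
    nbhs x A <->
    exists (n : nat) (e : R),
      0 < e /\ [set y | forall m, (m <= n)%N -> p m (y - x) < e] `<=` A.

(* Cauchy for the translation-invariant uniformity of X. *)
Definition cauchy_seq (x : nat -> X) : Prop :=
  forall U : set X, nbhs (0 : X) U ->
    exists N : nat, forall m n, (N <= m)%N -> (N <= n)%N -> U (x m - x n).

(* Sequential completeness is completeness here, because a countable family of
   seminorms makes X metrizable. *)
Definition frechet_space : Prop :=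
  [/\ hausdorff_space X,
      exists p : nat -> X -> R, (forall n, seminorm (p n)) /\ defines_topology p &
      forall x : nat -> X, cauchy_seq x -> exists l : X, x @ \oo --> l].

(* All sequences are indexed from 0: u 0 stands for the first term. *)
Definition linear_span (u : nat -> X) : set X :=
  [set x | exists (n : nat) (a : nat -> scalars R k),
             x = \sum_(i < n) a i *: u i].

Definition converges_to (a : nat -> scalars R k) (u : nat -> X) (x : X) : Prop :=
  series (fun n => a n *: u n) @ \oo --> x.

Definition basic_sequence (u : nat -> X) : Prop :=
  forall x : X, closure (linear_span u) x ->
    exists! a : nat -> scalars R k, converges_to a u x.

Definition equivalent_sequences (u f : nat -> X) : Prop :=
  forall a : nat -> scalars R k,
    (exists x : X, converges_to a u x) <-> (exists x : X, converges_to a f x).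

End Frechet.

(* Main.v *)
Require Import Defs.
From HB Require Import structures.
From mathcomp Require Import all_boot all_order all_algebra.
From mathcomp Require Import all_classical all_reals all_analysis.
From mathcomp Require Import complex ring.

(** Everything rests on two estimates for the partial sums
    S_n = a_0 u_0 + ... + a_(n-1) u_(n-1) of an arbitrary scalar sequence.

    - Multiplying the hypotheses on u gives p_j(S_m) <= K p_j(S_n) whenever
      j < m <= n, because the partial products of (1 + eps_i) increase to K
      ([almost_monotone_projections]).
    - Since a_i u_i is the difference of two consecutive partial sums and
      p_0(u_i) = 1, this yields |a_i| <= 2 K p_0(S_n) for i < n
      ([coefficient_bound]): the seminorm p_0 alone sees all coefficients.

    Such a pair of bounds, with any constants, makes a sequence basic and its
    closed span meet ker p_0 trivially ([basic_criterion]).  For x in the closed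
    span, choose finite combinations tending to x; by the coefficient bound
    their coefficients are Cauchy and have limits a_i, and the uniform bound on
    projections allows the two limits to be exchanged, so that sum a_i u_i = x.
    The coefficient bound passes to the limit as |a_i| <= D p_0(x), which gives
    uniqueness, and also x = 0 as soon as p_0(x) = 0.

    For the perturbation f, the coefficient bound gives
    p_j(S_n(u) - S_n(f)) <= 2 K (sum_i p_j(u_i - f_i)) p_0(S_n(u)).  The sum
    over i is finite for every j, since p_j <= p_i as soon as i >= j, and for
    j = 0 the whole factor is at most some d < 1.  Hence
    (1 - d) p_0(S_n(u)) <= p_0(S_n(f)), and for every j the quantities
    p_j(S_n(u)) and p_j(S_n(f)) are within constant factors of each other
    ([perturbation_dominated]).  Both bounds therefore carry over from u to f,
    and the two series sum a_i u_i and sum a_i f_i are Cauchy at the same time,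
    so that completeness of X gives the equivalence. *)

Set Implicit Arguments.
Unset Strict Implicit.
Unset Printing Implicit Defensive.

Import Order.TTheory GRing.Theory Num.Theory.
Import numFieldNormedType.Exports.

Local Open Scope classical_set_scope.
Local Open Scope ring_scope.

(** * The modulus on the real or complex scalars *)

Section Modulus.
Variables (R : realType) (k : scalar_kind).
Implicit Types a b : scalars R k.

Lemma modulus_ge0 a : 0 <= modulus a.
Proof.
by case: k a => [a|[x y]] /=; [exact: normr_ge0|exact: sqrtr_ge0].
Qed.

Lemma modulus0 : modulus (0 : scalars R k) = 0.
Proof. by case: k; [exact: normr0|exact: ComplexField.Normc.normc0]. Qed.

Lemma modulus_eq0 a : modulus a = 0 -> a = 0.
Proof.
case: k a => a /=; first by move=> /normr0_eq0.
exact: ComplexField.Normc.eq0_normc.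
Qed.

Lemma modulusN a : modulus (- a) = modulus a.
Proof. by case: k a => a /=; [exact: normrN|exact: normcN]. Qed.

Lemma modulusD a b : modulus (a + b) <= modulus a + modulus b.
Proof. by case: k a b => a b /=; [exact: ler_normD|exact: le_normcD]. Qed.

Lemma real_cauchy_lim (x : nat -> R) :
  (forall e, 0 < e -> exists N, forall m n, (N <= m)%N -> (N <= n)%N ->
     `|x m - x n| < e) ->
  exists l, forall e, 0 < e -> \forall n \near \oo, `|x n - l| < e.
Proof.
move=> x_cauchy.
have /cvg_ex[l xl] : cvg (x @ \oo).
  apply: cauchy_cvg; apply: cauchy_exP => e e0.
  have [N xN] := x_cauchy e e0.
  by exists (x N); exists N => // n /= Nn; rewrite /ball/=; exact: xN.
exists l => e e0; move/cvgrPdist_lt : xl => /(_ e e0).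
by apply: filterS => n; rewrite distrC.
Qed.

Lemma normc_le_ReIm (z : R[i]) :
  ComplexField.Normc.normc z <= `|complex.Re z| + `|complex.Im z|.
Proof.
case: z => x y /=.
rewrite -(@ger0_norm _ (`|x| + `|y|)) ?addr_ge0// -sqrtr_sqr ler_wsqrtr//.
by rewrite sqrrD !real_normK ?num_real// lerD2r lerDl mulrn_wge0// mulr_ge0.
Qed.

Lemma Re_le_normc (z : R[i]) :
  `|complex.Re z| <= ComplexField.Normc.normc z.
Proof.
by case: z => x y /=; rewrite -sqrtr_sqr ler_wsqrtr// lerDl sqr_ge0.
Qed.

Lemma Im_le_normc (z : R[i]) :
  `|complex.Im z| <= ComplexField.Normc.normc z.
Proof.
by case: z => x y /=; rewrite -sqrtr_sqr ler_wsqrtr// lerDr sqr_ge0.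
Qed.

(** The topology on the complex scalars comes from a norm with complex values,
    so completeness is derived for the real-valued modulus directly, from the
    convergence of the real and imaginary parts. *)
Lemma scalars_complete (a : nat -> scalars R k) :
  (forall e, 0 < e -> exists N, forall m n, (N <= m)%N -> (N <= n)%N ->
     modulus (a m - a n) < e) ->
  exists l, forall e, 0 < e -> \forall n \near \oo, modulus (a n - l) < e.
Proof.
case: k a => a /= a_cauchy; first exact: real_cauchy_lim.
have ReB (z w : R[i]) : complex.Re (z - w) = complex.Re z - complex.Re w.
  by case: z w => [? ?] [? ?].
have ImB (z w : R[i]) : complex.Im (z - w) = complex.Im z - complex.Im w.
  by case: z w => [? ?] [? ?].
have [|x ax] := @real_cauchy_lim (fun n => complex.Re (a n)).
  move=> e /a_cauchy[N aN]; exists N => m n Nm Nn.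
  by rewrite -ReB; exact: le_lt_trans (Re_le_normc _) (aN _ _ Nm Nn).
have [|y ay] := @real_cauchy_lim (fun n => complex.Im (a n)).
  move=> e /a_cauchy[N aN]; exists N => m n Nm Nn.
  by rewrite -ImB; exact: le_lt_trans (Im_le_normc _) (aN _ _ Nm Nn).
exists (Complex x y) => e e0; have e2 : 0 < e / 2 by rewrite divr_gt0.
near=> n.
apply: le_lt_trans (normc_le_ReIm _) _.
rewrite ReB ImB [e]splitr ltrD//.
  by near: n; exact: ax.
by near: n; exact: ay.
Unshelve. all: by end_near.
Qed.

End Modulus.

(** * Convergence in terms of the seminorms *)

Section SeminormTopology.
Variables (R : realType) (k : scalar_kind).
Variable X : topologicalLmodType (scalars R k).
Variable p : nat -> X -> R.
Implicit Types (x y z : X) (f : nat -> X) (a b : nat -> scalars R k) (e : R).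
Hypothesis p_seminorm : forall n, seminorm (p n).
Hypothesis p_increasing : forall n x, p n x <= p n.+1 x.
Hypothesis p_topology : defines_topology p.

Lemma seminorm_ge0 j x : 0 <= p j x.
Proof. by case: (p_seminorm j) => /(_ x). Qed.
#[local] Hint Resolve seminorm_ge0 : core.

Lemma seminormD j x y : p j (x + y) <= p j x + p j y.
Proof. by case: (p_seminorm j) => _ /(_ x y). Qed.

Lemma seminormZ j (a : scalars R k) x : p j (a *: x) = modulus a * p j x.
Proof. by case: (p_seminorm j). Qed.

Lemma seminorm0 j : p j 0 = 0.
Proof. by rewrite -(scale0r (0 : X)) seminormZ modulus0 mul0r. Qed.

Lemma seminormN j x : p j (- x) = p j x.
Proof. by rewrite -scaleN1r seminormZ modulusN -seminormZ scale1r. Qed.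

Lemma seminorm_distC j x y : p j (x - y) = p j (y - x).
Proof. by rewrite -opprB seminormN. Qed.

Lemma seminorm_dist_triangle j y x z : p j (x - z) <= p j (x - y) + p j (y - z).
Proof. by rewrite -[x - z](subrKA y); exact: seminormD. Qed.

Lemma seminorm_mono i j x : (i <= j)%N -> p i x <= p j x.
Proof.
elim: j => [|j IH]; first by rewrite leqn0 => /eqP->.
rewrite leq_eqVlt => /predU1P[->//|]; rewrite ltnS => /IH ij.
exact: le_trans ij (p_increasing _ _).
Qed.

Lemma seminorm_sum j n (F : 'I_n -> X) : p j (\sum_i F i) <= \sum_i p j (F i).
Proof.
elim/big_rec2: _ => [|i y x _ xy]; first by rewrite seminorm0.
by apply: le_trans (seminormD _ _ _) _; rewrite lerD2l.
Qed.

(** As the seminorms increase, one of them at a time describes the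
    neighbourhoods. *)
Lemma cvg_seminormP (x : nat -> X) (l : X) :
  x @ \oo --> l <->
  forall j e, 0 < e -> \forall n \near \oo, p j (x n - l) < e.
Proof.
split=> [xl j e e0|xl A /p_topology[j [e [e0 jA]]]].
  have /xl : nbhs l [set y | p j (y - l) < e].
    by apply/p_topology; exists j, e; split => // y /(_ j); exact.
  exact.
rewrite /nbhs /=; have := xl j e e0.
apply: filterS => n xnl; apply: jA => m mj.
exact: le_lt_trans (seminorm_mono _ mj) xnl.
Qed.

Lemma cauchy_seminormP (x : nat -> X) :
  cauchy_seq x <->
  forall j e, 0 < e -> exists N, forall m n, (N <= m)%N -> (N <= n)%N ->
    p j (x m - x n) < e.
Proof.
split=> [xC j e e0|xC A /p_topology[j [e [e0 jA]]]].
  have [|N xN] := xC [set y | p j y < e].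
    apply/p_topology; exists j, e; split => // y /(_ j).
    by rewrite subr0; exact.
  by exists N.
have [N xN] := xC j e e0; exists N => m n Nm Nn; apply: jA => i ij.
by rewrite subr0; exact: le_lt_trans (seminorm_mono _ ij) (xN _ _ Nm Nn).
Qed.

Lemma seminorm_cvg_cauchy (x : nat -> X) (l : X) :
  x @ \oo --> l -> cauchy_seq x.
Proof.
move=> /cvg_seminormP xl; apply/cauchy_seminormP => j e e0.
have e2 : 0 < e / 2 by rewrite divr_gt0.
have [N _ xN] := xl j _ e2.
exists N => m n Nm Nn; apply: le_lt_trans (seminorm_dist_triangle j l _ _) _.
by rewrite [e]splitr ltrD//; [|rewrite seminorm_distC]; exact: xN.
Qed.

Lemma seminorms_separate x :
  hausdorff_space X -> (forall j, p j x = 0) -> x = 0.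
Proof.
move=> X_T2 x0; apply/esym/X_T2 => A B /p_topology[j [e [e0 jA]]] Bx.
exists x; split; last exact: nbhs_singleton.
by apply: jA => m _; rewrite subr0 x0.
Qed.

Definition psum a f n := \sum_(i < n) a i *: f i.

Lemma psumS a f n : psum a f n.+1 = psum a f n + a n *: f n.
Proof. by rewrite /psum big_ord_recr. Qed.

Lemma psumB a b f n : psum (fun i => a i - b i) f n = psum a f n - psum b f n.
Proof. by rewrite /psum -sumrB; apply: eq_bigr => i _; rewrite scalerBl. Qed.

Lemma converges_toE a f x :
  converges_to a f x <-> (fun n => psum a f n) @ \oo --> x.
Proof. by rewrite /converges_to seriesEord. Qed.

(** Padding the coefficients of a finite combination with zeros makes its
    partial sums eventually constant; approximants of different lengths can then
    be compared at a common rank m. *)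
Lemma closure_span_approx f x j e : closure (linear_span f) x -> 0 < e ->
  exists a, \forall m \near \oo, p j (psum a f m - x) < e.
Proof.
move=> fx e0.
have [|y [[n [a ->]] axn]] := fx [set y | p j (y - x) < e].
  by apply/p_topology; exists j, e; split => // y /(_ j); exact.
exists (fun i => if (i < n)%N then a i else 0); exists n => // m /= nm.
suff -> : psum (fun i => if (i < n)%N then a i else 0) f m =
    \sum_(i < n) a i *: f i by [].
rewrite /psum (big_ord_widen _ (fun i => a i *: f i) nm) [RHS]big_mkcond.
by apply: eq_bigr => i _; case: ifP => //; rewrite scale0r.
Qed.

(** * The criterion for basic sequences *)

(** The inequalities to which this is applied compare p_j of partial sums only
    from rank j + 1 on; for the limit m --> oo at fixed j this is enough. *)
Definition bounded_projections f := forall j, exists2 C, 0 <= C &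
  forall a m n, (j < m <= n)%N -> p j (psum a f m) <= C * p j (psum a f n).

(** The bound is by the smallest seminorm, which is what makes the kernel of p 0
    meet the closed span trivially. *)
Definition bounded_coefficients f := exists2 D, 0 <= D &
  forall a n i, (i < n)%N -> modulus (a i) <= D * p 0%N (psum a f n).

Lemma converges_to_bound f a x c D i : 0 <= D ->
  (forall n, (i < n)%N -> c <= D * p 0%N (psum a f n)) ->
  converges_to a f x -> c <= D * p 0%N x.
Proof.
move=> D0 cD /converges_toE/cvg_seminormP ax; apply/ler_addgt0Pr => e e0.
have e'0 : 0 < e / (D + 1) by rewrite divr_gt0// ltr_wpDl.
near \oo => n.
have nx : p 0%N (psum a f n - x) < e / (D + 1) by near: n; exact: ax.
apply: (le_trans (cD n _)); first by near: n; exact: nbhs_infty_gt.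
have -> : D * p 0%N x + e = D * (p 0%N x + e / (D + 1)) + e / (D + 1).
  by field; rewrite gt_eqF// ltr_wpDl.
rewrite -[leLHS]addr0 lerD ?(ltW e'0)// ler_wpM2l//.
rewrite -[psum a f n](subrK x) addrC.
by apply: le_trans (seminormD _ _ _) _; rewrite lerD2l ltW.
Unshelve. all: by end_near.
Qed.

Lemma converges_toB a b f x y : converges_to a f x -> converges_to b f y ->
  converges_to (fun i => a i - b i) f (x - y).
Proof.
move=> /converges_toE/cvg_seminormP ax /converges_toE/cvg_seminormP bx.
apply/converges_toE/cvg_seminormP => j e e0.
have e2 : 0 < e / 2 by rewrite divr_gt0.
near=> n; rewrite psumB opprD addrACA -opprD.
rewrite [e]splitr; apply: le_lt_trans (seminormD _ _ _) _.
by rewrite seminormN ltrD//; near: n; [exact: ax|exact: bx].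
Unshelve. all: by end_near.
Qed.

Lemma psum_coefficients_cvg (c : nat -> nat -> scalars R k) a f j m :
  (forall i e, 0 < e -> \forall N \near \oo, modulus (c N i - a i) < e) ->
  forall e : R, 0 < e ->
    \forall N \near \oo, p j (psum (c N) f m - psum a f m) < e.
Proof.
move=> ca; elim: m => [|m IH] e e0.
  by near=> N; rewrite /psum !big_ord0 subr0 seminorm0.
have e2 : 0 < e / 2 by rewrite divr_gt0.
have q0 : 0 < p j (f m) + 1 by rewrite ltr_wpDl.
near=> N; rewrite !psumS opprD addrACA -scalerBl [e]splitr.
apply: le_lt_trans (seminormD _ _ _) _.
rewrite seminormZ ltrD//; first by near: N; exact: IH.
apply: le_lt_trans (_ : _ <= modulus (c N m - a m) * (p j (f m) + 1)) _.
  by rewrite ler_wpM2l ?modulus_ge0// lerDl.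
by rewrite -ltr_pdivlMr//; near: N; apply: ca; rewrite divr_gt0.
Unshelve. all: by end_near.
Qed.

Lemma natSinv_eventually_lt e : 0 < e -> \forall N \near \oo, N.+1%:R^-1 < e.
Proof. by move=> e0; exact: (near_infty_natSinv_lt (PosNum e0)). Qed.

(** Write S_m(b) for psum b f m, and let c N be the coefficients of approximants
    of x.  They are Cauchy in N, index by index; call a the limit.  For m > j
    the p_j-distance from S_m(c N) to S_m(a) is the limit over M of
    p_j(S_m(c N - c M)), which is at most a constant times p_j of the difference
    of the approximants themselves, uniformly in m.  As S_m(c N) is close to x
    for large m, S_m(a) --> x. *)
Lemma closure_span_expansion f x :
  bounded_projections f -> bounded_coefficients f ->
  closure (linear_span f) x -> exists a, converges_to a f x.
Proof.
move=> f_proj [D D0 f_coef] fx.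
have /choice[c cx] : forall N, exists a,
    \forall m \near \oo, p N (psum a f m - x) < N.+1%:R^-1.
  by move=> N; apply: closure_span_approx; rewrite ?invr_gt0.
have cxj j N e : (j <= N)%N -> N.+1%:R^-1 < e ->
    \forall m \near \oo, p j (psum (c N) f m - x) < e.
  move=> jN Ne; apply: filterS (cx N) => m cNm.
  by rewrite (le_lt_trans (seminorm_mono _ jN))// (lt_trans cNm).
have /choice[a ca] : forall i, exists l, forall e : R, 0 < e ->
    \forall N \near \oo, modulus (c N i - l) < e.
  move=> i; apply: scalars_complete => e e0.
  have D1 : 0 < 2 * (D + 1) by rewrite mulr_gt0// ltr_wpDl.
  have e'0 : 0 < e / (2 * (D + 1)) by rewrite divr_gt0.
  have [N0 _ N0e] := natSinv_eventually_lt e'0.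
  exists N0 => M N /N0e Me /N0e Ne.
  near \oo => n.
  have Mn : p 0%N (psum (c M) f n - x) < e / (2 * (D + 1)).
    by near: n; exact: cxj.
  have Nn : p 0%N (psum (c N) f n - x) < e / (2 * (D + 1)).
    by near: n; exact: cxj.
  have MNn : p 0%N (psum (c M) f n - psum (c N) f n) <= e / (D + 1).
    have -> : e / (D + 1) = e / (2 * (D + 1)) + e / (2 * (D + 1)).
      by field; rewrite gt_eqF// ltr_wpDl.
    apply: le_trans (seminorm_dist_triangle 0 x _ _) _.
    by rewrite lerD// ?[p _ (x - _)]seminorm_distC ltW.
  apply: (@le_lt_trans _ _ (D * (e / (D + 1)))).
    apply: le_trans (f_coef (fun i => c M i - c N i) n i _) _.
      by near: n; exact: nbhs_infty_gt.
    by rewrite psumB ler_wpM2l.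
  by rewrite mulrCA gtr_pMr// ltr_pdivrMr ?mul1r ?ltrDl// ltr_wpDl.
exists a; apply/converges_toE/cvg_seminormP => j e e0.
(* S_m(a) is compared with x through S_m(c M) and S_m(c N).  The outer two
   differences are below d; the middle one is at most C (d + d), by comparison
   with a larger rank n where both sums are within d of x. *)
have [C C0 f_C] := f_proj j.
have C2 : 0 < 2 * C + 2 by rewrite ltr_wpDl// mulr_ge0.
pose d := e / (2 * C + 2).
have d0 : 0 < d by rewrite divr_gt0.
have [N jN Nd] : exists2 N, (j <= N)%N & N.+1%:R^-1 < d.
  near \oo => N; exists N; near: N; first exact: nbhs_infty_ge.
  exact: natSinv_eventually_lt.
near=> m.
have jm : (j < m)%N by near: m; exact: nbhs_infty_gt.
have Nm : p j (psum (c N) f m - x) < d by near: m; exact: cxj.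
near \oo => M.
have jM : (j <= M)%N by near: M; exact: nbhs_infty_ge.
have Md : M.+1%:R^-1 < d by near: M; exact: natSinv_eventually_lt.
have aM : p j (psum (c M) f m - psum a f m) < d.
  by near: M; exact: psum_coefficients_cvg.
near \oo => n.
have Mn : p j (psum (c M) f n - x) < d by near: n; exact: (cxj _ _ _ jM Md).
have Nn : p j (psum (c N) f n - x) < d by near: n; exact: (cxj _ _ _ jN Nd).
have mn : (m <= n)%N by near: n; exact: nbhs_infty_ge.
have MN : p j (psum (c M) f m - psum (c N) f m) <= C * (d + d).
  rewrite -psumB; apply: le_trans (f_C _ m n _) _; first by rewrite jm.
  rewrite psumB ler_wpM2l//; apply: le_trans (seminorm_dist_triangle j x _ _) _.
  by rewrite lerD// ?[p _ (x - _)]seminorm_distC ltW.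
have -> : e = d + (C * (d + d) + d) by rewrite /d; field; rewrite gt_eqF.
apply: le_lt_trans (seminorm_dist_triangle j (psum (c M) f m) _ _) _.
rewrite ltrD//; first by rewrite seminorm_distC.
apply: le_lt_trans (seminorm_dist_triangle j (psum (c N) f m) _ _) _.
by rewrite ler_ltD.
Unshelve. all: by end_near.
Qed.

Theorem basic_criterion f : hausdorff_space X ->
  bounded_projections f -> bounded_coefficients f ->
  basic_sequence f /\
  closure (linear_span f) `&` [set x | p 0%N x = 0] = [set 0].
Proof.
move=> X_T2 f_proj f_coef; have [D D0 f_D] := f_coef.
have coef0 a x i : converges_to a f x -> p 0%N x = 0 -> a i = 0.
  move=> ax x0; apply/modulus_eq0/le_anti; rewrite modulus_ge0 andbT.
  rewrite -[leRHS](mulr0 D) -x0.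
  by apply: converges_to_bound D0 _ ax => n; exact: f_D.
split.
  move=> x fx; have [a ax] := closure_span_expansion f_proj f_coef fx.
  exists a; split=> // b bx; apply/funext => i; apply/subr0_eq.
  have := converges_toB ax bx; rewrite subrr => /coef0 abi.
  exact: (abi i (seminorm0 0)).
apply/seteqP; split=> [x [fx /= x0]|_ ->]; last first.
  split; last by rewrite /= seminorm0.
  by apply: subset_closure; exists 0%N, (fun=> 0); rewrite big_ord0.
have [a ax] := closure_span_expansion f_proj f_coef fx.
have a0 n : psum a f n = 0.
  by rewrite /psum big1// => i _; rewrite (coef0 _ _ i ax x0) scale0r.
apply: seminorms_separate => // j; apply/le_anti; rewrite seminorm_ge0 andbT.
apply/ler_addgt0Pr => e e0; rewrite add0r.
move/converges_toE/cvg_seminormP : ax => /(_ j e e0)[N _ /(_ N (leqnn N))] /=.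
by rewrite a0 sub0r seminormN => /ltW.
Qed.

(** * Comparison of two sequences *)

(** Differences of partial sums are themselves partial sums, so that estimates
    on partial sums transfer the Cauchy property. *)
Lemma psum_tail a f m n : (n <= m)%N ->
  psum (fun i => if (i < n)%N then 0 else a i) f m = psum a f m - psum a f n.
Proof.
move=> nm; apply/eqP; rewrite eq_sym subr_eq; apply/eqP.
rewrite /psum (big_ord_widen _ (fun i => a i *: f i) nm).
rewrite [X in _ = _ + X]big_mkcond -big_split; apply: eq_bigr => i _ /=.
by case: ifP; rewrite ?scale0r ?add0r ?addr0.
Qed.

Definition dominated f g := forall j, exists2 C, 0 <= C &
  forall a n, p j (psum a f n) <= C * p j (psum a g n).

Lemma dominated_bounded_projections f g : dominated f g -> dominated g f ->
  bounded_projections g -> bounded_projections f.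
Proof.
move=> fg gf g_proj j.
have [A A0 fA] := fg j; have [B B0 gB] := gf j; have [C C0 gC] := g_proj j.
exists (A * (C * B)); first by rewrite !mulr_ge0.
move=> a m n jmn; apply: le_trans (fA _ _) _.
rewrite -!mulrA ler_wpM2l//; apply: le_trans (gC _ _ _ jmn) _.
by rewrite ler_wpM2l.
Qed.

Lemma dominated_bounded_coefficients f g : dominated g f ->
  bounded_coefficients g -> bounded_coefficients f.
Proof.
move=> /(_ 0%N)[B B0 gB] [D D0 gD]; exists (D * B); first by rewrite mulr_ge0.
move=> a n i ni; apply: le_trans (gD _ _ _ ni) _.
by rewrite -mulrA ler_wpM2l.
Qed.

Lemma dominated_converges f g a : frechet_space X -> dominated f g ->
  (exists x, converges_to a g x) -> exists x, converges_to a f x.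
Proof.
move=> [_ _ X_complete] fg [x /converges_toE gx].
suff /X_complete[y fy] : cauchy_seq (psum a f).
  by exists y; apply/converges_toE.
apply/cauchy_seminormP => j e e0; have [C C0 fC] := fg j.
have C1 : 0 < C + 1 by rewrite ltr_wpDl.
have /cauchy_seminormP/(_ j (e / (C + 1)))[|N gN] := seminorm_cvg_cauchy gx.
  by rewrite divr_gt0.
have tail m n : (N <= n)%N -> (n <= m)%N -> p j (psum a f m - psum a f n) < e.
  move=> Nn nm; rewrite -psum_tail//; apply: le_lt_trans (fC _ _) _.
  rewrite psum_tail//.
  apply: (@le_lt_trans _ _ ((C + 1) * p j (psum a g m - psum a g n))).
    by rewrite ler_wpM2r// lerDl.
  by rewrite mulrC -ltr_pdivlMr//; apply: gN => //; exact: leq_trans nm.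
exists N => m n Nm Nn; case: (leqP n m) => [|/ltnW] nm; first exact: tail.
by rewrite seminorm_distC; exact: tail.
Qed.

(** Only the finitely many indices i < j are not covered by p_j <= p_i. *)
Lemma sum_seminorms_bounded (w : nat -> X) B :
  (forall n, \sum_(i < n) p i (w i) <= B) ->
  forall j, exists B', forall n, \sum_(i < n) p j (w i) <= B'.
Proof.
move=> wB j; exists (\sum_(i < j) p j (w i) + B) => n.
apply: (@le_trans _ _
    (\sum_(i < j) p j (w i) + \sum_(i < n) p i (w i))); last first.
  by rewrite lerD2l.
elim: n => [|n IH]; first by rewrite !big_ord0 addr0 sumr_ge0.
have [nj|jn] := ltnP n j.
  apply: (@le_trans _ _ (\sum_(i < j) p j (w i))).
    rewrite (big_ord_widen _ (fun i => p j (w i)) nj) big_mkcond.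
    by apply: ler_sum => i _; case: ifP.
  by rewrite lerDl sumr_ge0.
by rewrite !big_ord_recr/= addrA lerD// seminorm_mono.
Qed.

(** The difference of the two partial sums is controlled by p_0 of the sum along
    u, with a factor d < 1 for j = 0.  Absorbing that term on the left bounds
    p_0 of the sum along u by p_0, hence by p_j, of the sum along f. *)
Lemma perturbation_dominated f (u : nat -> X) (D d : R) :
  0 < D ->
  (forall a n i, (i < n)%N -> modulus (a i) <= D * p 0%N (psum a u n)) ->
  d < 1 -> (forall n, \sum_(i < n) D * p i (u i - f i) <= d) ->
  dominated f u /\ dominated u f.
Proof.
move=> D0 uD d1 ufd.
have d0 : 0 <= d by have := ufd 0%N; rewrite big_ord0.
have psum_diff j B a n : \sum_(i < n) p j (u i - f i) <= B ->
    p j (psum a u n - psum a f n) <= D * B * p 0%N (psum a u n).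
  move=> ufB; rewrite /psum -sumrB; apply: le_trans (seminorm_sum _ _) _.
  apply: (@le_trans _ _
      (\sum_(i < n) D * p 0%N (psum a u n) * p j (u i - f i))).
    by apply: ler_sum => i _; rewrite -scalerBr seminormZ ler_wpM2r// uD.
  by rewrite -mulr_sumr mulrAC ler_wpM2r// ler_wpM2l// ltW.
have ufb n : \sum_(i < n) p i (u i - f i) <= D^-1 * d.
  by rewrite mulrC ler_pdivlMr// mulrC mulr_sumr.
have diff0 a n : p 0%N (psum a u n - psum a f n) <= d * p 0%N (psum a u n).
  have <- : D * (D^-1 * d) = d by rewrite mulrA divff ?gt_eqF// mul1r.
  apply: psum_diff; apply: le_trans _ (ufb n).
  by apply: ler_sum => i _; exact: seminorm_mono.
have diffj j : exists2 B, 0 <= B & forall a n,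
    p j (psum a u n - psum a f n) <= B * p 0%N (psum a u n).
  have [B ufB] := @sum_seminorms_bounded (fun i => u i - f i) _ ufb j.
  exists (D * B); last by move=> a n; exact: psum_diff.
  by rewrite mulr_ge0 ?(ltW D0)//; have := ufB 0%N; rewrite big_ord0.
split=> j; have [B B0 ufB] := diffj j.
  exists (B + 1); first by rewrite addr_ge0.
  move=> a n; rewrite -[psum a f n](subrK (psum a u n)).
  apply: le_trans (seminormD _ _ _) _.
  rewrite mulrDl mul1r lerD2r seminorm_distC.
  by apply: le_trans (ufB _ _) _; rewrite ler_wpM2l// seminorm_mono.
have d'0 : 0 < 1 - d by rewrite subr_gt0.
exists (B / (1 - d) + 1); first by rewrite addr_ge0// divr_ge0// ltW.
move=> a n; rewrite -[in leLHS](subrK (psum a f n) (psum a u n)).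
apply: le_trans (seminormD _ _ _) _; rewrite mulrDl mul1r lerD2r.
apply: le_trans (ufB _ _) _; rewrite -mulrA ler_wpM2l// mulrC ler_pdivlMr//.
apply: (@le_trans _ _ (p 0%N (psum a f n))); last exact: seminorm_mono.
rewrite mulrBr mulr1 lerBlDr addrC [_ * d]mulrC.
rewrite -[in leLHS](subrK (psum a f n) (psum a u n)).
by apply: le_trans (seminormD _ _ _) _; rewrite lerD2r.
Qed.

(** * The two bounds for the original sequence *)

(** For fixed a and S_n = psum a u n, the sequence P_n p_j(S_(n+1)), where P_n is
    the product of the factors 1 + eps_i for i < n, is nondecreasing for n >= j,
    and 1 <= P_n <= K. *)
Lemma almost_monotone_projections (eps : nat -> R) (K : R) (u : nat -> X) :
  (forall n, 0 < eps n) ->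
  (fun n : nat => \prod_(i < n) (1 + eps i)) @ \oo --> K ->
  (forall (n j : nat) a, (j <= n)%N ->
     p j (psum a u n.+1) <= (1 + eps n) * p j (psum a u n.+2)) ->
  1 <= K /\
  forall j a m n, (j < m <= n)%N -> p j (psum a u m) <= K * p j (psum a u n).
Proof.
move=> eps0 epsK u_ineq; pose P n := \prod_(i < n) (1 + eps i).
have P_nd : {homo P : m n / (m <= n)%N >-> m <= n}.
  apply/nondecreasing_seqP => n; rewrite /P big_ord_recr /=.
  apply: ler_peMr; last by rewrite lerDl ltW.
  by apply: prodr_ge0 => i _; rewrite addr_ge0 ?ltW.
have P_le n : P n <= K.
  rewrite -(cvg_lim (@Rhausdorff R) epsK).
  by apply: nondecreasing_cvgn_le => //; apply/cvg_ex; exists K.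
have P_ge1 n : 1 <= P n by have := P_nd _ _ (leq0n n); rewrite /P big_ord0.
split; first exact: le_trans (P_ge1 0%N) _.
move=> j a [|m] [|n] /andP[] //; rewrite !ltnS => jm mn.
have step l : P m * p j (psum a u m.+1) <=
    P (m + l)%N * p j (psum a u (m + l).+1).
  elim: l => [|l IH]; first by rewrite addn0.
  apply: le_trans IH _; rewrite addnS /P big_ord_recr /= -mulrA ler_wpM2l//.
    exact: le_trans ler01 (P_ge1 _).
  by apply: u_ineq; exact: leq_trans jm (leq_addr _ _).
apply: (@le_trans _ _ (P m * p j (psum a u m.+1))); first by rewrite ler_peMl.
have := step (n - m)%N; rewrite subnKC// => /le_trans; apply.
by rewrite ler_wpM2r.
Qed.

Lemma coefficient_bound (K : R) (u : nat -> X) :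
  1 <= K ->
  (forall a m n, (0 < m <= n)%N ->
    p 0%N (psum a u m) <= K * p 0%N (psum a u n)) ->
  (forall n, p 0%N (u n) = 1) ->
  forall a n i, (i < n)%N -> modulus (a i) <= 2 * K * p 0%N (psum a u n).
Proof.
move=> K1 uK u1 a n i ni.
have -> : modulus (a i) = p 0%N (psum a u i.+1 - psum a u i).
  by rewrite psumS addrAC subrr add0r seminormZ u1 mulr1.
rewrite -mulrA mulr_natl mulr2n.
apply: le_trans (seminormD _ _ _) _; rewrite seminormN.
apply: lerD; first exact: uK.
case: i ni => [|i] ni; last by apply: uK; rewrite /= ltnW.
by rewrite /psum big_ord0 seminorm0 mulr_ge0// (le_trans ler01).
Qed.

End SeminormTopology.

(** * The perturbation theorem *)

Theorem theorem1p7 (R : realType) (k : scalar_kind)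
    (X : topologicalLmodType (scalars R k))
    (p : nat -> X -> R) (eps : nat -> R) (K : R) (u : nat -> X)
    (X_frechet : frechet_space X)
    (p_seminorm : forall n, seminorm (p n))
    (p_increasing : forall n x, p n x <= p n.+1 x)
    (p_topology : defines_topology p)
    (eps_gt0 : forall n, 0 < eps n)
    (eps_prod : (fun n : nat => \prod_(i < n) (1 + eps i)) @ \oo --> K)
    (u_ineq : forall (n j : nat) (a : nat -> scalars R k), (j <= n)%N ->
       p j (\sum_(i < n.+1) a i *: u i)
       <= (1 + eps n) * p j (\sum_(i < n.+2) a i *: u i))
    (u_norm : forall n, p 0%N (u n) = 1) :
  [/\ basic_sequence u,
      closure (linear_span u) `&` [set x | p 0%N x = 0] = [set 0] &
      forall f : nat -> X,
        (\sum_(0 <= i <oo) (2 * K * p i (u i - f i))%:E < 1%:E)%E ->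
        [/\ basic_sequence f,
            equivalent_sequences f u &
            closure (linear_span f) `&` [set x | p 0%N x = 0] = [set 0]]].
Proof.
have [X_T2 _ _] := X_frechet.
have [K1 uK] :=
  almost_monotone_projections p_seminorm eps_gt0 eps_prod u_ineq.
have K0 : 0 < 2 * K by rewrite mulr_gt0// (lt_le_trans ltr01).
have u_coef := coefficient_bound p_seminorm K1 (uK 0%N) u_norm.
have u_bproj : bounded_projections p u.
  by move=> j; exists K; [exact: le_trans ler01 _|exact: uK].
have u_bcoef : bounded_coefficients p u by exists (2 * K) => //; exact: ltW.
have basic f :=
  @basic_criterion _ _ _ _ p_seminorm p_increasing p_topology f X_T2.
have [u_basic u_ker] := basic u u_bproj u_bcoef.
split=> // f uf.
have term0 i : 0 <= 2 * K * p i (u i - f i).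
  by apply: mulr_ge0; [exact: ltW|exact: seminorm_ge0].
have partial n : ((\sum_(i < n) 2 * K * p i (u i - f i))%:E <=
    \sum_(0 <= i <oo) (2 * K * p i (u i - f i))%:E)%E.
  rewrite -sumEFin -(big_mkord xpredT (fun i => (2 * K * p i (u i - f i))%:E)).
  by apply: nneseries_lim_ge => i _ _; rewrite lee_fin.
have [d d1 ufd] : exists2 d : R, d < 1 &
    forall n, \sum_(i < n) 2 * K * p i (u i - f i) <= d.
  case: (X in (X < 1%:E)%E) uf partial => [d| |] // d1 ufd.
    by exists d => // n; rewrite -lee_fin.
  by have := ufd 0%N.
have [fu uf'] :=
  perturbation_dominated p_seminorm p_increasing K0 u_coef d1 ufd.
have [f_basic f_ker] := basic f
  (dominated_bounded_projections fu uf' u_bproj)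
  (dominated_bounded_coefficients uf' u_bcoef).
split=> // a.
by split;
  apply: (dominated_converges p_seminorm p_increasing p_topology X_frechet).
Qed.
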